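(* Let $\|\cdot\|_1$ and $\|\cdot\|_2$ be two norms on $\mathbb{C}^n$. Then $\|\cdot\|_{1,2}$ is an algebra norm on $M_n$ if and only if $\|\cdot\|_1\le\|\cdot\|_2$, i.e. $\|x\|_1\le\|x\|_2$ for all $x\in\mathbb{C}^n$.
   Context: $M_n$ denotes the complex algebra of all $n\times n$ matrices over $\mathbb{C}$. Given norms $\|\cdot\|_1,\|\cdot\|_2$ on $\mathbb{C}^n$, the generalized induced norm $\|\cdot\|_{1,2}$ on $M_n$ is defined by $\|A\|_{1,2}=\max\{\|Ax\|_2:\|x\|_1=1\}$. An algebra norm on $M_n$ is a norm $\|\cdot\|$ on $M_n$ such that $\|AB\|\le\|A\|\,\|B\|$ for all $A,B\in M_n$. *)

(* Defs.v *)
From mathcomp Require Import all_boot all_order all_algebra.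
From mathcomp Require Import classical_sets reals.
From mathcomp.real_closed Require Import complex.

Set Implicit Arguments.
Unset Strict Implicit.
Unset Printing Implicit Defensive.

Import Order.TTheory GRing.Theory Num.Theory.

Local Open Scope ring_scope.
Local Open Scope complex_scope.
Local Open Scope classical_set_scope.

(* Norms are real-valued functions on a complex vector space; the library's
   normed-module structures over [R[i]] take their values in [R[i]] instead and
   attach a single norm to each type.  [ComplexField.Normc.normc] is the
   [R]-valued modulus of a complex number. *)
Record is_norm (R : realType) (V : lmodType R[i]) (N : V -> R) : Prop := IsNorm {
  is_norm_ge0 : forall x : V, 0 <= N x;
  is_norm_eq0 : forall x : V, N x = 0 -> x = 0;
  is_normZ : forall (a : R[i]) (x : V), N (a *: x) = ComplexField.Normc.normc a * N x;
  is_normD : forall x y : V, N (x + y) <= N x + N y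
}.

Record is_algebra_norm (R : realType) (n : nat) (N : 'M[R[i]]_n -> R) : Prop :=
  IsAlgebraNorm {
  algebra_norm_is_norm : is_norm N;
  algebra_normM : forall A B : 'M[R[i]]_n, N (A *m B) <= N A * N B
}.

(* The greatest element of [S]; the value is 0 when [S] has none. *)
Definition set_max (R : realType) (S : set R) : R :=
  xget 0 [set m : R | S m /\ ubound S m].

Definition induced_norm (R : realType) (n : nat) (N1 N2 : 'cV[R[i]]_n -> R)
    (A : 'M[R[i]]_n) : R :=
  set_max [set N2 (A *m x) | x in [set x : 'cV[R[i]]_n | N1 x = 1]].

(* Main.v *)
Require Import Defs.
From mathcomp Require Import all_boot all_order all_algebra.
From mathcomp Require Import boolp classical_sets reals.
From mathcomp Require Import topology normedtype derive.
From mathcomp Require Import ring lra.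
From mathcomp.real_closed Require Import complex.

Set Implicit Arguments.
Unset Strict Implicit.
Unset Printing Implicit Defensive.

Import Order.TTheory GRing.Theory Num.Theory.
Import numFieldNormedType.Exports.
Import ComplexField.Normc.

Local Open Scope ring_scope.
Local Open Scope complex_scope.
Local Open Scope classical_set_scope.

(** Submultiplicativity of the induced norm is tested on rank-one matrices.

    The maximum defining [induced_norm N1 N2 A] exists because norms on C^n are
    continuous and their unit spheres are compact
    ([induced_norm_attained]).  It follows that this number is the best
    constant [c] with [N2 (A x) <= c * N1 x] ([induced_norm_bound],
    [induced_norm_le]), and hence that it is a norm in [A].

    If [N1 <= N2], then [N2 (A B x) <= |A| * N1 (B x) <= |A| * N2 (B x)
    <= |A| * |B| * N1 x], so the norm is submultiplicative.

    Conversely, suppose [N2 y = 1 < N1 y].  As [y] lies outside the unit ball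
    of [N1], some linear functional [a] satisfies [|a x| <= c * N1 x] for all
    [x] and yet [c < |a y|] ([norm_ball_separation], a form of the Hahn-Banach
    theorem).  For the rank-one matrix [A := y a], which maps [x] to [(a x) y],
    the first property says that [|A| <= c].  Moreover [A A = (a y) A], so that
    [|A A| = |a y| * |A| > c * |A| >= |A| * |A|]: the norm is not
    submultiplicative.

    The separating functional comes from Euclidean geometry: if [p] is the
    point of the unit ball of [N1] nearest to [y], the real part of the
    Hermitian product with [y - p] is at most its value at [p] on the ball
    and larger at [y]; as the ball is stable under multiplication by complex
    numbers of modulus 1, the same bound holds for the modulus of that
    product. *)

Local Notation Re := complex.Re.
Local Notation Im := complex.Im.

(** * The modulus of a complex number *)

Section Modulus.
Variable R : realType.
Implicit Types c : R[i].

Lemma normcR (r : R) : normc r%:C = `|r|.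
Proof. by rewrite /= expr0n addr0 sqrtr_sqr. Qed.

Lemma normc_ge0 c : 0 <= normc c.
Proof. by case: c => a b; exact: sqrtr_ge0. Qed.

Lemma Re_le_normc c : Re c <= normc c.
Proof.
case: c => a b /=; apply: le_trans (ler_norm a) _.
by rewrite -sqrtr_sqr ler_wsqrtr// lerDl sqr_ge0.
Qed.

Lemma normc_rotation c : exists2 u : R[i], normc u = 1 & u * c = (normc c)%:C.
Proof.
have [->|c0] := eqVneq c 0.
  by exists 1; rewrite ?normc1// normc0 mulr0.
have nc0 : normc c != 0 by apply: contra c0 => /eqP/eq0_normc ->.
exists ((normc c)%:C / c); last by rewrite divfK.
rewrite normcM normcV normcR ger0_norm ?divff//.
exact: normc_ge0.
Qed.

End Modulus.

(** * Seminorms and norms *)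

(** Seminorms are needed because [x |-> N (A *m x)] is not a norm when [A] is
    singular, while the continuity of that function is what makes the induced
    norm a maximum. *)
Record is_seminorm (R : realType) (V : lmodType R[i]) (N : V -> R) : Prop :=
  IsSeminorm {
  is_seminorm_ge0 : forall x : V, 0 <= N x;
  is_seminormZ : forall (a : R[i]) (x : V), N (a *: x) = normc a * N x;
  is_seminormD : forall x y : V, N (x + y) <= N x + N y
}.

Lemma norm_seminorm (R : realType) (V : lmodType R[i]) (N : V -> R) :
  is_norm N -> is_seminorm N.
Proof. by case=> *; split. Qed.

Lemma seminorm_mulmx (R : realType) (m n : nat) (A : 'M[R[i]]_(m, n))
    (N : 'cV[R[i]]_m -> R) :
  is_seminorm N -> is_seminorm (fun x : 'cV[R[i]]_n => N (A *m x)).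
Proof.
move=> hN; split=> [x|a x|x y]; first exact: is_seminorm_ge0 hN _.
  by rewrite -scalemxAr (is_seminormZ hN).
by rewrite mulmxDr; exact: is_seminormD hN _ _.
Qed.

Section SeminormTheory.
Variables (R : realType) (V : lmodType R[i]) (N : V -> R).
Hypothesis hN : is_seminorm N.

Lemma seminorm_scale_real (r : R) x : N (r%:C *: x) = `|r| * N x.
Proof. by rewrite (is_seminormZ hN) normcR. Qed.

Lemma seminorm0 : N 0 = 0.
Proof.
by rewrite -(scale0r 0) (is_seminormZ hN) normc0 mul0r.
Qed.

Lemma seminormN x : N (- x) = N x.
Proof.
have -> : - x = (-1 : R)%:C *: x by rewrite rmorphN1 scaleN1r.
by rewrite seminorm_scale_real normrN normr1 mul1r.
Qed.

Lemma seminorm_dist x y : `|N x - N y| <= N (x - y).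
Proof.
have h u v : N u - N v <= N (u - v).
  by rewrite lerBlDr -{1}(subrK v u) (is_seminormD hN).
by rewrite ler_norml lerNl opprB h -(seminormN (x - y)) opprB h.
Qed.

End SeminormTheory.

Section NormTheory.
Variables (R : realType) (V : lmodType R[i]) (N : V -> R).
Hypothesis hN : is_norm N.

Lemma norm_gt0 x : x != 0 -> 0 < N x.
Proof.
move=> x0; rewrite lt_def (is_norm_ge0 hN) andbT.
by apply: contra x0 => /eqP/(is_norm_eq0 hN) ->.
Qed.

Lemma norm_unit_scale x : x != 0 -> N ((N x)^-1%:C *: x) = 1.
Proof.
move=> /norm_gt0 x0; rewrite (seminorm_scale_real (norm_seminorm hN)).
by rewrite ger0_norm ?invr_ge0 ?ltW// mulVf ?gt_eqF.
Qed.

End NormTheory.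

(** * Norms on C^n in real coordinates *)

Section RealCoordinates.
Variables (R : realType) (n : nat).
Implicit Types (v w : 'rV[R]_(n + n)) (x : 'cV[R[i]]_n).

(** C^n is parametrized by R^(2n), real parts first and imaginary parts second,
    so that the sup norm of R^(2n) and the Heine-Borel theorem apply to it. *)
Definition of_real v : 'cV[R[i]]_n :=
  \col_j (v 0 (lshift n j) +i* v 0 (rshift n j)).

Definition to_real x : 'rV[R]_(n + n) :=
  row_mx (\row_j Re (x j 0)) (\row_j Im (x j 0)).

Lemma to_realK : cancel to_real of_real.
Proof.
move=> x; apply/matrixP => i j; rewrite ord1 !mxE.
by rewrite (unsplitK (inl _ _)) (unsplitK (inr _ _)) !mxE; case: (x i 0).
Qed.

Lemma of_realB v w : of_real (v - w) = of_real v - of_real w.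
Proof. by apply/matrixP => i j; rewrite !mxE. Qed.

Lemma of_realD v w : of_real (v + w) = of_real v + of_real w.
Proof. by apply/matrixP => i j; rewrite !mxE. Qed.

Lemma of_real0 : of_real 0 = 0.
Proof. by apply/matrixP => i j; rewrite !mxE. Qed.

Lemma of_realZ (r : R) v : of_real (r *: v) = r%:C *: of_real v.
Proof. by apply/matrixP => i j; rewrite !mxE; simpc. Qed.

Lemma of_real_eq0 v : of_real v = 0 -> v = 0.
Proof.
move=> /matrixP v0; apply/matrixP => i j; rewrite ord1 mxE.
by case: (split_ordP j) => k ->; have := v0 k 0; rewrite !mxE => -[].
Qed.

Implicit Types N : 'cV[R[i]]_n -> R.

(** Expanding [v] in the canonical basis bounds [N (of_real v)] by the sum of the
    values of [N] at the basis vectors, times the sup norm of [v]. *)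
Lemma seminorm_le_mx_norm N : is_seminorm N ->
  exists2 M : R, 0 < M & forall v, N (of_real v) <= M * `|v|.
Proof.
move=> hN.
(* The summand 1 only makes the constant positive. *)
exists (1 + \sum_k N (of_real (delta_mx 0 k))).
  by rewrite ltr_wpDr// sumr_ge0// => k _; exact: is_seminorm_ge0 hN _.
move=> v; rewrite {1}(row_sum_delta v) mulrDl mul1r mulr_suml.
apply: ler_wpDl => //.
elim/big_ind2 : _ => [|w a w' b hw hw'|k _].
- by rewrite of_real0 (seminorm0 hN).
- by rewrite of_realD; apply: le_trans (is_seminormD hN _ _) _; exact: lerD.
- rewrite of_realZ (seminorm_scale_real hN) mulrC ler_wpM2l ?(is_seminorm_ge0 hN)//.
  rewrite [leRHS]/Num.norm /= mx_normrE; apply/bigmax_geP; right => /=.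
  by exists (0, k).
Qed.

Lemma seminorm_continuous N : is_seminorm N -> continuous (N \o of_real).
Proof.
move=> hN.
have [M M0 hM] := seminorm_le_mx_norm hN.
move=> v; apply: (proj2 (@cvgrPdist_lt _ _ _ (nbhs v) _ _ _)) => e e0; near=> w.
apply: le_lt_trans (seminorm_dist hN _ _) _; rewrite -of_realB.
apply: le_lt_trans (hM _) _; rewrite mulrC -ltr_pdivlMr//.
near: w; apply: cvgr_dist_lt; last by rewrite divr_gt0.
exact: cvg_id.
Unshelve. all: by end_near.
Qed.

(** The constant is the minimum of [N] on the compact unit sphere of the sup norm,
    positive because a norm does not vanish there. *)
Lemma norm_ge_mx_norm N : is_norm N ->
  exists2 m : R, 0 < m & forall v, m * `|v| <= N (of_real v).
Proof.
move=> hN.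
(* In dimension 0 the unit sphere is empty and any constant works. *)
have [[v0 v00]|no] := pselect (exists v : 'rV[R]_(n + n), v != 0); last first.
  exists 1 => // v; have [->|v0] := eqVneq v 0; last by case: no; exists v.
  by rewrite normr0 mulr0 (is_norm_ge0 hN).
pose S := [set v : 'rV[R]_(n + n) | `|v| = 1].
have unitS v : v != 0 -> S (`|v|^-1 *: v).
  by move=> v_neq0; rewrite /S /= normrZ normfV normr_id mulVf// normr_eq0.
have cS : compact S.
  apply: bounded_closed_compact.
    exists 1; split => // r r1 v; rewrite /S /= => ->; exact: ltW.
  apply: (@preimage_closed _ R^o (fun v : 'rV[R]_(n + n) => `|v|) [set 1]).
    by move=> v _; exact: norm_continuous.
  exact: closed_eq.
have S0 : S !=set0 by exists (`|v0|^-1 *: v0); exact: unitS.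
have cN : {within S, continuous (N \o of_real)}.
  exact: continuous_subspaceT (seminorm_continuous (norm_seminorm hN)).
have [v1 /set_mem Sv1 minv1] := EVT_min_rV S0 cS cN.
exists (N (of_real v1)).
  apply: (norm_gt0 hN); apply/eqP => /of_real_eq0 v10.
  by move: Sv1; rewrite v10 /S /= normr0 => /esym/eqP; rewrite oner_eq0.
move=> v; have [->|v_neq0] := eqVneq v 0.
  by rewrite normr0 mulr0 (is_norm_ge0 hN).
have := minv1 _ (mem_set (unitS v v_neq0)).
rewrite /= of_realZ (seminorm_scale_real (norm_seminorm hN)) normfV normr_id.
by rewrite ler_pdivlMl ?normr_gt0// mulrC.
Qed.

(** Boundedness may be measured with any norm [N], since [N] dominates a positive
    multiple of the sup norm; the set is then compact by Heine-Borel. *)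
Lemma bounded_closed_attains_min N (A : set 'cV[R[i]]_n)
    (f : 'cV[R[i]]_n -> R) (r : R) :
  is_norm N -> A !=set0 -> (forall x, A x -> N x <= r) ->
  closed (of_real @^-1` A) -> continuous (f \o of_real) ->
  exists2 x, A x & forall y, A y -> f x <= f y.
Proof.
move=> hN [x0 Ax0] Ar clA cf; have [m m0 hm] := norm_ge_mx_norm hN.
have cA : compact (of_real @^-1` A).
  apply: bounded_closed_compact => //.
  exists (r / m); split; first exact: num_real.
  move=> s rs v Av; apply: le_trans (ltW rs).
  by rewrite ler_pdivlMr// mulrC (le_trans (hm v))// Ar.
have A0 : of_real @^-1` A !=set0 by exists (to_real x0); rewrite /= to_realK.
have [v /set_mem Av minv] := EVT_min_rV A0 cA (continuous_subspaceT cf).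
exists (of_real v) => // y Ay.
by have := minv (to_real y); rewrite /= to_realK; apply; rewrite inE /= to_realK.
Qed.

End RealCoordinates.

(** * Separating a point from the unit ball of a norm *)

Section Separation.
Variables (R : realType) (n : nat).
Implicit Types (u d x z : 'cV[R[i]]_n).

(** The Euclidean inner product of R^(2n); it is the real part of the Hermitian
    product of C^n, as [Re_conj_row] shows. *)
Definition re_dot u x : R :=
  \sum_j (Re (u j 0) * Re (x j 0) + Im (u j 0) * Im (x j 0)).

Definition conj_row u : 'rV[R[i]]_n := \row_j conjc (u j 0).

Lemma Re_conj_row u x : Re ((conj_row u *m x) 0 0) = re_dot u x.
Proof.
rewrite mxE (big_morph (@complex.Re R) (id1 := 0) (op1 := +%R)) //; last first.
  by move=> [? ?] [? ?].
apply: eq_bigr => j _; rewrite mxE; case: (u j 0) (x j 0) => [a b] [c d] /=.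
by rewrite mulNr opprK.
Qed.

Lemma re_dot_ge0 u : 0 <= re_dot u u.
Proof. by apply: sumr_ge0 => j _; rewrite addr_ge0 -?expr2 ?sqr_ge0. Qed.

Lemma re_dotB u x y : re_dot u (x - y) = re_dot u x - re_dot u y.
Proof.
rewrite /re_dot -sumrB; apply: eq_bigr => j _; rewrite !mxE.
by case: (u j 0) (x j 0) (y j 0) => [? ?] [? ?] [? ?] /=; ring.
Qed.

Lemma re_dot_eq0 u : re_dot u u = 0 -> u = 0.
Proof.
move=> u0; apply/matrixP => j k; rewrite ord1 mxE {k}.
have /eqP := u0; rewrite psumr_eq0; last first.
  by move=> i _; rewrite addr_ge0 -?expr2 ?sqr_ge0.
move=> /allP/(_ j (mem_index_enum _)) /=; case: (u j 0) => a b /=.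
by rewrite -!expr2 paddr_eq0 ?sqr_ge0// !sqrf_eq0 => /andP[/eqP -> /eqP ->].
Qed.

Lemma re_dot_line u d (t : R) :
  re_dot (u - t%:C *: d) (u - t%:C *: d) =
  re_dot u u - 2 * t * re_dot u d + t ^+ 2 * re_dot d d.
Proof.
rewrite /re_dot !mulr_sumr -sumrB -big_split; apply: eq_bigr => j _.
by rewrite !mxE; case: (u j 0) (d j 0) => [a b] [c e] /=; ring.
Qed.

Lemma re_dot_continuous z :
  continuous ((fun x => re_dot (z - x) (z - x)) \o @of_real R n).
Proof.
pose f (v : 'rV[R]_(n + n)) : R :=
  \sum_j ((Re (z j 0) - v 0 (lshift n j)) ^+ 2 +
          (Im (z j 0) - v 0 (rshift n j)) ^+ 2).
have -> : (fun x => re_dot (z - x) (z - x)) \o @of_real R n = f.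
  apply/funext => v; apply: eq_bigr => j _; rewrite !mxE.
  by case: (z j 0) => a b /=; rewrite -!expr2.
have cB (c : R) k : continuous (fun v : 'rV[R]_(n + n) => (c - v 0 k) ^+ 2).
  move=> v.
  have cv : {for v, continuous (fun w : 'rV[R]_(n + n) => c - w 0 k)}.
    by apply: continuousB; [exact: cst_continuous | exact: coord_continuous].
  exact: (continuousM cv cv).
apply: continuous_big => [|j _ v]; first exact: add_continuous.
exact: (continuousD (cB _ _ v) (cB _ _ v)).
Qed.

Variable N : 'cV[R[i]]_n -> R.
Hypothesis hN : is_norm N.

(** Nearest-point argument.  For [p] nearest to [z] in the unit ball and
    [u := z - p], moving from [p] towards a point [x] of the ball cannot
    decrease the distance to [z]; to first order this says
    [re_dot u (x - p) <= 0].  Applied to [w *: x] with [w] of modulus 1 chosen so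
    that the Hermitian product becomes a nonnegative real, this bounds the modulus
    on the whole ball, while [re_dot u z - re_dot u p = re_dot u u > 0]. *)
Lemma norm_ball_separation z : 1 < N z ->
  exists a : 'rV[R[i]]_n, exists c : R,
    (forall x, normc ((a *m x) 0 0) <= c * N x) /\ c < normc ((a *m z) 0 0).
Proof.
move=> z1; have hS := norm_seminorm hN.
have [||||p] := @bounded_closed_attains_min R n N [set x | N x <= 1]
    (fun x => re_dot (z - x) (z - x)) 1 hN.
- by exists 0; rewrite /= (seminorm0 hS).
- by [].
- suff : closed ((N \o @of_real R n) @^-1` [set r | r <= 1]) by [].
  apply: preimage_closed; last exact: closed_le.
  by move=> v _; exact: seminorm_continuous.
- exact: re_dot_continuous.
move=> /= p1 minp; set u := z - p in minp.
have u_gt0 : 0 < re_dot u u.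
  rewrite lt_def re_dot_ge0 andbT; apply/eqP => /re_dot_eq0/eqP.
  by rewrite subr_eq0 => /eqP zp; move: z1; rewrite zp ltNge p1.
have proj x : N x <= 1 -> re_dot u x <= re_dot u p.
  move=> x1; rewrite -subr_le0 -re_dotB leNgt; apply/negP.
  set d := x - p; set s := re_dot u d => s_gt0.
  have e_ge0 := re_dot_ge0 d; set e := re_dot d d in e_ge0.
  have se_gt0 : 0 < s + e by rewrite ltr_pwDl.
  (* The squared distance changes by [t ^+ 2 * e - 2 * t * s] along the step [t];
     this step is at most 1 and satisfies [t * e <= s], so the change is
     negative. *)
  pose t := s / (s + e).
  have t_gt0 : 0 < t by rewrite divr_gt0.
  have t_le1 : t <= 1 by rewrite ler_pdivrMr// mul1r lerDl.
  have tE : t * (s + e) = s by rewrite divfK// gt_eqF.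
  have := minp (p + t%:C *: d); rewrite opprD (addrA z) -/u re_dot_line -/s -/e.
  have -> : p + t%:C *: d = (1 - t)%:C *: p + t%:C *: x.
    by apply/matrixP => i j; rewrite !mxE rmorphB rmorph1; ring.
  have K : N ((1 - t)%:C *: p + t%:C *: x) <= 1.
    apply: le_trans (is_normD hN _ _) _.
    rewrite !(seminorm_scale_real hS) ger0_norm ?subr_ge0// (ger0_norm (ltW t_gt0)).
    nra.
  move=> /(_ K); nra.
exists (conj_row u), (re_dot u p); split=> [x|].
  have [->|x0] := eqVneq x 0.
    by rewrite mulmx0 mxE normc0 (seminorm0 hS) mulr0.
  have [w w1 wE] := normc_rotation ((conj_row u *m x) 0 0).
  have /proj : N (w *: ((N x)^-1%:C *: x)) <= 1.
    by rewrite (is_normZ hN) w1 mul1r norm_unit_scale.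
  have entryZ k (M : 'M[R[i]]_1) : (k *: M) 0 0 = k * M 0 0 by rewrite mxE.
  rewrite -Re_conj_row -!scalemxAr !entryZ mulrCA wE -rmorphM /=.
  by rewrite ler_pdivrMl ?(norm_gt0 hN)// mulrC.
rewrite -Re_conj_row; apply: lt_le_trans (Re_le_normc _).
by rewrite !Re_conj_row -subr_gt0 -re_dotB.
Qed.

End Separation.

(** * The induced norm *)

Section InducedNorm.
Variables (R : realType) (n : nat) (n_gt0 : (0 < n)%N).
Variables (N1 N2 : 'cV[R[i]]_n -> R) (hN1 : is_norm N1) (hN2 : is_norm N2).
Local Notation norm12 := (induced_norm N1 N2).

(** [induced_norm] is 0 by default when the maximum does not exist; this lemma
    rules that case out.  The sphere is nonempty because [0 < n]. *)
Lemma induced_norm_attained A :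
  (exists2 x, N1 x = 1 & norm12 A = N2 (A *m x)) /\
  forall x, N1 x = 1 -> N2 (A *m x) <= norm12 A.
Proof.
have [||||x x1 maxx] := @bounded_closed_attains_min R n N1 [set x | N1 x = 1]
    (fun x => - N2 (A *m x)) 1 hN1.
- have x0 : const_mx 1 != 0 :> 'cV[R[i]]_n.
    apply/eqP => /matrixP/(_ (Ordinal n_gt0) 0); rewrite !mxE => /eqP.
    by rewrite oner_eq0.
  by exists ((N1 (const_mx 1))^-1%:C *: const_mx 1); exact: norm_unit_scale.
- by move=> x /= ->.
- suff : closed ((N1 \o @of_real R n) @^-1` [set r | r = 1]) by [].
  apply: preimage_closed; last exact: closed_eq.
  by move=> v _; exact: seminorm_continuous (norm_seminorm hN1) _.
- have cA := seminorm_continuous (seminorm_mulmx A (norm_seminorm hN2)).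
  by move=> v; exact: (continuousN (cA v)).
set S := [set N2 (A *m x) | x in [set x | N1 x = 1]].
have : [set m | S m /\ ubound S m] (norm12 A).
  apply: xgetPex; exists (N2 (A *m x)); split; first by exists x.
  by move=> _ [y y1 <-]; have := maxx y y1; rewrite lerN2.
move=> [[y y1 <-] ub]; split; first by exists y.
by move=> w w1; apply: ub; exists w.
Qed.

Lemma induced_norm_bound A x : N2 (A *m x) <= norm12 A * N1 x.
Proof.
have [->|x0] := eqVneq x 0.
  by rewrite mulmx0 !(seminorm0 (norm_seminorm _))// mulr0.
have := (induced_norm_attained A).2 _ (norm_unit_scale hN1 x0).
rewrite -scalemxAr (seminorm_scale_real (norm_seminorm hN2)).
rewrite ger0_norm ?invr_ge0 ?(is_norm_ge0 hN1)//.
by rewrite ler_pdivrMl ?(norm_gt0 hN1)// mulrC.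
Qed.

Lemma induced_norm_le A (c : R) :
  (forall x, N2 (A *m x) <= c * N1 x) -> norm12 A <= c.
Proof.
by move=> hc; have [[x x1 ->] _] := induced_norm_attained A; rewrite -[c]mulr1 -x1.
Qed.

Lemma induced_norm_ge0 A : 0 <= norm12 A.
Proof. by have [[x _ ->] _] := induced_norm_attained A; exact: is_norm_ge0 hN2 _. Qed.

Lemma induced_norm_is_norm : is_norm norm12.
Proof.
split=> [A|A A0|a A|A B].
- exact: induced_norm_ge0.
- apply/matrixP => i j; rewrite mxE.
  (* [A] kills every vector, in particular the basis vector giving column [j]. *)
  have /matrixP/(_ i 0) : A *m delta_mx j 0 = 0 :> 'cV_n.
    apply: (is_norm_eq0 hN2); apply: le_anti; rewrite (is_norm_ge0 hN2) andbT.
    by rewrite -(mul0r (N1 (delta_mx j 0))) -A0 induced_norm_bound.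
  by rewrite -colE !mxE.
- apply: le_anti; apply/andP; split.
    apply: induced_norm_le => x; rewrite -scalemxAl (is_normZ hN2) -mulrA.
    by rewrite ler_wpM2l ?normc_ge0// induced_norm_bound.
  have [[x x1 ->] _] := induced_norm_attained A.
  by rewrite -(is_normZ hN2) scalemxAl -[leRHS]mulr1 -x1 induced_norm_bound.
- apply: induced_norm_le => x; rewrite mulmxDl mulrDl.
  by apply: le_trans (is_normD hN2 _ _) _; apply: lerD; exact: induced_norm_bound.
Qed.

End InducedNorm.

(** * Rank-one matrices and the characterization *)

Lemma mulmx_rank1 (R : comPzRingType) (n : nat) (z : 'cV[R]_n)
    (a : 'rV[R]_n) (x : 'cV[R]_n) :
  z *m a *m x = (a *m x) 0 0 *: z.
Proof. by rewrite -mulmxA {1}[a *m x]mx11_scalar mul_mx_scalar. Qed.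

Theorem theorem2p7 (R : realType) (n : nat) (n_gt0 : (0 < n)%N)
    (N1 N2 : 'cV[R[i]]_n -> R) (hN1 : is_norm N1) (hN2 : is_norm N2) :
  is_algebra_norm (induced_norm N1 N2) <->
  (forall x : 'cV[R[i]]_n, N1 x <= N2 x).
Proof.
split=> [[_ submul] z|le12].
  have [->|z0] := eqVneq z 0.
    by rewrite !(seminorm0 (norm_seminorm _)).
  rewrite leNgt; apply/negP => lt21.
  have N2z := norm_gt0 hN2 z0.
  pose y := (N2 z)^-1%:C *: z.
  have y1 : N2 y = 1 by exact: norm_unit_scale.
  have /(norm_ball_separation hN1)[a [c [ac cy]]] : 1 < N1 y.
    rewrite (seminorm_scale_real (norm_seminorm hN1)).
    by rewrite ger0_norm ?invr_ge0 ?ltW// ltr_pdivlMl ?mulr1.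
  pose A : 'M[R[i]]_n := y *m a; pose r := (a *m y) 0 0.
  have norm12 := induced_norm_is_norm n_gt0 hN1 hN2.
  have Ac : induced_norm N1 N2 A <= c.
    apply: (induced_norm_le n_gt0 hN1 hN2) => x.
    by rewrite mulmx_rank1 (is_normZ hN2) y1 mulr1.
  have AA : A *m A = r *: A.
    by rewrite /A mulmxA mulmx_rank1 -scalemxAl.
  have c_ge0 : 0 <= c := le_trans (is_norm_ge0 norm12 A) Ac.
  have r_gt0 : 0 < normc r by exact: le_lt_trans cy.
  have A_gt0 : 0 < induced_norm N1 N2 A.
    apply: (norm_gt0 norm12); apply/eqP => A0.
    have : N2 (A *m y) = 0 by rewrite A0 mul0mx (seminorm0 (norm_seminorm hN2)).
    rewrite mulmx_rank1 (is_normZ hN2) y1 mulr1 => r0.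
    by rewrite r0 ltxx in r_gt0.
  have := submul A A; rewrite AA (is_normZ norm12) ler_pM2r// => rA.
  by have := lt_le_trans cy (le_trans rA Ac); rewrite ltxx.
split=> [|A B]; first exact: induced_norm_is_norm.
apply: (induced_norm_le n_gt0 hN1 hN2) => x; rewrite -mulmxA -mulrA.
have bound := induced_norm_bound n_gt0 hN1 hN2.
apply: le_trans (bound A _) _.
rewrite ler_wpM2l ?(induced_norm_ge0 n_gt0 hN1 hN2)//.
exact: le_trans (le12 _) (bound B x).
Qed.
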